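(* Let $\boldsymbol\theta=(\theta_1,\dots,\theta_p)\in\mathbb{R}^p$, let $g$ be a prior distribution on $\mathbb{R}$, and for each $j=1,\dots,p$ let $$s_j^2(\boldsymbol\theta)=\frac{a(\phi)}{\sum_{i=1}^n b''(\boldsymbol x_i^T\boldsymbol\theta)\,x_{ij}^2},\qquad r_j(\boldsymbol\theta,g)=\min_{q_j:\ \mathbb{E}_{q_j}(\beta_j)=\theta_j}\left(\frac{1}{2s_j^2(\boldsymbol\theta)}V_{q_j}+D_{KL}(q_j\,\|\,g)\right),$$ where $V_{q_j}$ is the variance of $\beta_j$ under $q_j$. For each $j$, let $z_g(\theta_j)$ be a solution $z\in\mathbb{R}$ of $$\theta_j=z+s_j^2(\boldsymbol\theta)\,l'_{\mathrm{NM}}\bigl(z;g,s_j^2(\boldsymbol\theta)\bigr),$$ where $l'_{\mathrm{NM}}$ is the derivative with respect to $z$ of the log marginal likelihood of the Bayesian normal mean model, $$l_{\mathrm{NM}}(z;g,s^2)=\log\int N(z;b,s^2)\,g(b)\,db.$$ Then $$r_j(\boldsymbol\theta,g)=-l_{\mathrm{NM}}\bigl(z_g(\theta_j);g,s_j^2(\boldsymbol\theta)\bigr)+\log N\bigl(z_g(\theta_j);\theta_j,s_j^2(\boldsymbol\theta)\bigr).$$ Moreover, the optimal $q_j$ in the definition of $r_j(\boldsymbol\theta,g)$ is $$q_j(\cdot)=\frac{g(\cdot)\,N\bigl(\cdot\,;z_g(\theta_j),s_j^2(\boldsymbol\theta)\bigr)}{c(z_g(\theta_j))},\qquad c(z_g(\theta_j))=\int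 g(b)\,N\bigl(z_g(\theta_j);b,s_j^2(\boldsymbol\theta)\bigr)\,db.$$
   Context: Setting. Data $(\boldsymbol x_i,y_i)$, $i=1,\dots,n$, with $\boldsymbol x_i=(x_{i1},\dots,x_{ip})^T\in\mathbb{R}^p$ and $y_i\in\mathbb{R}$, follow a canonical generalized linear model $$p(y_i\mid\boldsymbol\beta)=\exp\left(\frac{y_i\eta_i-b(\eta_i)}{a(\phi)}+c(y_i,\phi)\right),\qquad \eta_i=\boldsymbol x_i^T\boldsymbol\beta,$$ with known dispersion $\phi$ and $a(\phi)>0$; $b(\cdot)$ is the (twice differentiable, convex) log-partition function, and $\sum_i b''(\boldsymbol x_i^T\boldsymbol\theta)x_{ij}^2>0$, so that $s_j^2(\boldsymbol\theta)$ is a well-defined positive number. (The integration variable $b$ in $l_{\mathrm{NM}}$ and $c(z_g(\theta_j))$, and the function $c(y_i,\phi)$, are unrelated to the function $b(\cdot)$ and the constant $c(z_g(\theta_j))$ respectively.) The coefficients have prior $\beta_j\overset{\text{i.i.d.}}{\sim}g$, where $g$ is an arbitrary probability distribution on $\mathbb{R}$. It may have atoms, in which case $g(b)\,db$ means integration against the measure $g$, and the formula for the optimal $q_j$ means that $q_j$ has density $N(\cdot\,;z_g(\theta_j),s_j^2(\boldsymbol\theta))/c(z_g(\theta_j))$ with respect to $g$. Notation. $N(x;\mu,s^2)=(2\pi s^2)^{-1/2}\exp(-(x-\mu)^2/(2s^2))$ is the normal density. $D_{KL}$ is the Kullback–Leibler divergence, equal to $+\infty$ when $q_j$ is not absolutely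 continuous with respect to $g$. In the definition of $r_j$, $q_j$ ranges over all probability distributions on $\mathbb{R}$ (with finite second moment) whose mean is $\theta_j$. Bayesian normal mean model: $z\mid b\sim N(b,s^2)$, $b\sim g$; its log marginal likelihood is $l_{\mathrm{NM}}(z;g,s^2)$. *)

(* Defs.v *)
From HB Require Import structures.
From mathcomp Require Import all_boot all_order all_algebra.
From mathcomp Require Import all_classical all_reals all_analysis.

Set Implicit Arguments.
Unset Strict Implicit.
Unset Printing Implicit Defensive.

Import Order.TTheory GRing.Theory Num.Theory.
Import numFieldNormedType.Exports.

Local Open Scope ring_scope.
Local Open Scope classical_set_scope.

(* The density of y_i is taken with respect to an unspecified base measure,
   and b is not tied to it by a normalization condition: every b that is twice
   differentiable and convex is allowed. *)
Record canonical_glm (R : realType) (n p : nat) := CanonicalGLM {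
  glm_x : 'M[R]_(n, p);
  glm_y : 'cV[R]_n;
  glm_phi : R;
  glm_a : R -> R;
  glm_b : R -> R;
  glm_c : R -> R -> R;
  glm_a_gt0 : 0 < glm_a glm_phi;
  glm_b_derivable : forall eta : R, derivable glm_b eta 1;
  glm_b_derivable2 : forall eta : R, derivable (derive1 glm_b) eta 1;
  glm_b_convex : convex_function [set: R] glm_b
}.

Section Defs.
Context {R : realType}.

Section GLM.
Context {n p : nat}.
Implicit Types (m : canonical_glm R n p) (theta beta : 'cV[R]_p).

Definition glm_eta m beta (i : 'I_n) : R := (glm_x m *m beta) i 0.

Definition glm_density m beta (i : 'I_n) : R :=
  let y := glm_y m i 0 in
  let eta := glm_eta m beta i in
  expR ((y * eta - glm_b m eta) / glm_a m (glm_phi m) + glm_c m y (glm_phi m)).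

Definition glm_information m theta (j : 'I_p) : R :=
  \sum_(i < n) derive1n 2 (glm_b m) (glm_eta m theta i) * glm_x m i j ^+ 2.

Definition glm_s2 m theta (j : 'I_p) : R :=
  glm_a m (glm_phi m) / glm_information m theta j.

End GLM.

(* [normal_pdf] takes the standard deviation, [N] the variance. *)
Definition N (x mu s2 : R) : R := normal_pdf mu (Num.sqrt s2) x.

Definition marginal_NM (z : R) (g : probability R R) (s2 : R) : R :=
  (\int[g]_b N z b s2)%R.

Definition l_NM (z : R) (g : probability R R) (s2 : R) : R :=
  ln (marginal_NM z g s2).

Definition l_NM' (z : R) (g : probability R R) (s2 : R) : R :=
  derive1 (fun t : R => l_NM t g s2) z.

Definition KL (q g : probability R R) : \bar R :=
  if `[< q `<< g >]
  then (\int[q]_b lne (Radon_Nikodym (charge_of_finite_measure q) g b))%E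
  else +oo%E.

Definition mean_constrained (theta : R) : set (probability R R) :=
  [set q | ('E_q[fun b : R => (b ^+ 2)%R] < +oo)%E /\
           ('E_q[fun b : R => b] = theta%:E)%E].

Definition penalty (s2 : R) (g q : probability R R) : \bar R :=
  ((2 * s2)^-1%:E * 'V_q[fun b : R => b] + KL q g)%E.

Definition is_optimal (theta s2 : R) (g q : probability R R) : Prop :=
  mean_constrained theta q /\
  forall q', mean_constrained theta q' -> (penalty s2 g q <= penalty s2 g q')%E.

(* The minimum in the definition of r_j, as an infimum in the extended reals;
   that it is attained is part of the theorem. *)
Definition glm_r n p (m : canonical_glm R n p) (theta : 'cV[R]_p)
    (g : probability R R) (j : 'I_p) : \bar R :=
  ereal_inf [set penalty (glm_s2 m theta j) g q
            | q in mean_constrained (theta j 0)].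

(* q has density N(.; z, s2) / c(z) with respect to g. *)
Definition is_posterior_NM (z s2 : R) (g q : probability R R) : Prop :=
  forall A : set R, measurable A ->
    q A = (\int[g]_(b in A) (N b z s2 / marginal_NM z g s2)%:E)%E.

End Defs.

(* Main.v *)
(* Write p(b) = N(b; z, s2) / c(z). Since -ln p is a quadratic in b, for every q
   with mean theta and finite second moment
     V_q / (2 s2) + KL(q, g) = C + (KL(q, g) - E_q[ln p]),
   where C = - l_NM(z) + ln N(z; theta, s2). Gibbs' inequality bounds the
   bracket below by 0, with equality only when q has density p with respect to
   g. Tweedie's formula, i.e. differentiation of the marginal under the
   integral sign, says that the equation defining z makes this q admissible. *)
Require Import Defs.
From HB Require Import structures.
From mathcomp Require Import all_boot all_order all_algebra.
From mathcomp Require Import all_classical all_reals all_analysis.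
From mathcomp Require Import measurable_realfun ring lra.

Set Implicit Arguments.
Unset Strict Implicit.
Unset Printing Implicit Defensive.

Import Order.TTheory GRing.Theory Num.Theory.
Import numFieldNormedType.Exports.

Local Open Scope ring_scope.

(** * Densities of probability measures *)

Section density.
Context d (T : measurableType d) (R : realType).
Local Open Scope classical_set_scope.
Local Open Scope ereal_scope.

(** The density is real-valued and nonnegative everywhere, not just almost everywhere, so that
    [ln (F x)] makes sense pointwise and stays measurable. *)
Definition has_density (g q : probability T R) (F : T -> R) : Prop :=
  [/\ measurable_fun setT F, forall x, (0 <= F x)%R &
      forall A, measurable A -> q A = \int[g]_(x in A) (F x)%:E].

Implicit Types (g q : probability T R) (F p : T -> R).

(** Needed when [u] has infinite integral. Then both sides are [+oo]: the negative part of [f + u]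
    is dominated by that of [f], so its integral is finite, while the positive part cannot have a
    finite integral because [u] is at most [(f + u)^+ + f^-]. *)
Lemma integralD_ge0 (mu : {measure set T -> \bar R}) (f u : T -> R) :
  mu.-integrable setT (EFin \o f) -> measurable_fun setT u ->
  (forall x, (0 <= u x)%R) ->
  \int[mu]_x (f x + u x)%:E = \int[mu]_x (f x)%:E + \int[mu]_x (u x)%:E.
Proof.
move=> intf meas_u u0.
have mf : measurable_fun setT f by apply/measurable_EFinP; exact: measurable_int intf.
have [uoo|] := ltP (\int[mu]_x (u x)%:E) +oo.
  apply: integralD_EFin => //; apply/integrableP; split; first exact/measurable_EFinP.
  by under eq_integral do rewrite gee0_abs ?lee_fin//.
rewrite leye_eq => /eqP uoo; rewrite uoo addey; last first.
  by have := integrable_fin_num measurableT intf; case: (integral _ _ _).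
pose h := EFin \o (fun x => f x + u x)%R.
have mh : measurable_fun setT h by apply/measurable_EFinP; exact: measurable_funD.
have hN x : h^\- x <= (EFin \o f)^\- x.
  rewrite !funenegE/= -?EFinN -!EFin_max lee_fin ge_max !le_max lexx orbT andbT.
  by rewrite lerN2 lerDl u0.
have Nfin : \int[mu]_x h^\- x \is a fin_num.
  rewrite ge0_fin_numE ?integral_ge0//.
  apply: le_lt_trans (integral_funeneg_lt_pinfty measurableT intf).
  by apply: ge0_le_integral => //; apply: measurable_funeneg => //; exact/measurable_EFinP.
rewrite (integralE _ _ h).
suff -> : \int[mu]_x h^\+ x = +oo.
  by rewrite addye//; move: Nfin; rewrite -fin_numN; case: (- _).
apply/eqP; rewrite -leye_eq leNgt; apply/negP => Pfin.
have /eqP := uoo; apply/negP; rewrite lt_eqF//.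
apply: (@le_lt_trans _ _ (\int[mu]_x (h^\+ x + (EFin \o f)^\- x))).
  apply: ge0_le_integral => //.
  - by move=> x _; rewrite lee_fin.
  - exact/measurable_EFinP.
  - by apply: emeasurable_funD; [exact: measurable_funepos|
      apply: measurable_funeneg; exact/measurable_EFinP].
  move=> x _; rewrite funeposE funenegE /= -?EFinN -!EFin_max -EFinD lee_fin.
  rewrite -[leLHS](addrK (f x)) (addrC (u x)).
  by rewrite lerD// le_max lexx.
rewrite ge0_integralD//; [|exact: measurable_funepos|].
  by rewrite lte_add_pinfty// integral_funeneg_lt_pinfty.
by apply: measurable_funeneg; exact/measurable_EFinP.
Qed.

Lemma has_density_dominates g q F : has_density g q F -> q `<< g.
Proof.
move=> [mF F0 qE]; apply/null_content_dominatesP => A mA gA0.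
rewrite qE//; apply: null_set_integral => //.
exact/measurable_funTS/measurable_EFinP.
Qed.

Lemma has_density_ex g q : q `<< g -> exists F, has_density g q F.
Proof.
move=> qg.
have fin := Radon_Nikodym_SigmaFinite.f_fin_num qg.
have fE : (fun x => (fine (Radon_Nikodym_SigmaFinite.f q g x))%:E) =
    Radon_Nikodym_SigmaFinite.f q g by apply/funext => x; rewrite fineK.
exists (fine \o Radon_Nikodym_SigmaFinite.f q g); split.
- apply/measurable_EFinP; rewrite /comp fE.
  exact: measurable_int (Radon_Nikodym_SigmaFinite.f_integrable qg).
- by move=> x; apply: fine_ge0; exact: Radon_Nikodym_SigmaFinite.f_ge0.
- by move=> A mA; rewrite /= fE; exact: Radon_Nikodym_SigmaFinite.f_integral.
Qed.

(** Both functions have integral [q A] over every measurable [A], which determines an integrable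
    function up to a null set. *)
Lemma has_density_ae_eq g q F : has_density g q F ->
  ae_eq g setT (Radon_Nikodym_SigmaFinite.f q g) (EFin \o F).
Proof.
move=> dF; have qg := has_density_dominates dF; have [mF F0 qE] := dF.
apply: integral_ae_eq => //.
- exact: Radon_Nikodym_SigmaFinite.f_integrable.
- exact/measurable_EFinP.
- by move=> A _ mA; rewrite -Radon_Nikodym_SigmaFinite.f_integral//; exact: qE.
Qed.

Lemma has_density_Radon_Nikodym g q F : has_density g q F ->
  ae_eq g setT (Radon_Nikodym (charge_of_finite_measure q) g) (EFin \o F).
Proof.
move=> dF; have qg := has_density_dominates dF.
apply: ae_eq_trans (has_density_ae_eq dF).
exact/ae_eq_sym/ae_eq_Radon_Nikodym_SigmaFinite.
Qed.

Lemma ge0_integral_density g q F (h : T -> \bar R) : has_density g q F ->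
  (forall x, 0 <= h x) -> measurable_fun setT h ->
  \int[q]_x h x = \int[g]_x (h x * (F x)%:E).
Proof.
move=> dF h0 mh; have qg := has_density_dominates dF; have [mF F0 qE] := dF.
rewrite -(Radon_Nikodym_SigmaFinite.change_of_variables qg)//.
have mf := measurable_int _ (Radon_Nikodym_SigmaFinite.f_integrable qg).
apply: ae_eq_integral => //.
- exact: emeasurable_funM.
- by apply: emeasurable_funM => //; exact/measurable_EFinP.
- exact/ae_eqe_mul2l/has_density_ae_eq.
Qed.

Lemma integral_density g q F (h : T -> \bar R) : has_density g q F ->
  q.-integrable setT h ->
  \int[q]_x h x = \int[g]_x (h x * (F x)%:E).
Proof.
move=> dF inth; have qg := has_density_dominates dF; have [mF F0 qE] := dF.
have mh : measurable_fun setT h := measurable_int _ inth.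
rewrite -(Radon_Nikodym_change_of_variables qg)//.
have mf : measurable_fun setT (Radon_Nikodym (charge_of_finite_measure q) g).
  exact: measurable_int (Radon_Nikodym_integrable _).
apply: ae_eq_integral => //.
- exact: emeasurable_funM.
- by apply: emeasurable_funM => //; exact/measurable_EFinP.
- exact/ae_eqe_mul2l/has_density_Radon_Nikodym.
Qed.

(** The zero set of [F] has [q]-mass equal to the integral of 0 over it. *)
Lemma has_density_gt0 g q F : has_density g q F -> {ae q, forall x, (0 < F x)%R}.
Proof.
move=> [mF F0 qE].
have mA : measurable [set x | F x = 0%R].
  by have := mF measurableT [set 0%R] (measurable_set1 _); rewrite setTI; exact.
exists [set x | F x = 0%R]; split => //.
  rewrite qE// -(integral0 g [set x | F x = 0%R]).
  by apply: eq_integral => x; rewrite inE /= => ->.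
by move=> x /= /negP; rewrite lt0r F0 andbT negbK => /eqP.
Qed.

(** The hypothesis at the complement of [A] gives the reverse inequality, since both total masses
    are 1. *)
Lemma probability_le_eq q q' :
  (forall A, measurable A -> q A <= q' A) -> forall A, measurable A -> q A = q' A.
Proof.
move=> le A mA; apply/eqP; rewrite eq_le le//=.
have := le _ (measurableC mA); rewrite !probability_setC//.
rewrite -(fineK (fin_num_measure q A mA)) -(fineK (fin_num_measure q' A mA)).
by rewrite -!EFinB !lee_fin lerD2l lerN2.
Qed.

Lemma probability_of_density g p : measurable_fun setT p ->
  (forall x, (0 <= p x)%R) -> \int[g]_x (p x)%:E = 1 ->
  exists q : probability T R, has_density g q p.
Proof.
move=> mp p0 p1.
pose nu A := \int[g]_(x in A) (p x)%:E.
have intp : g.-integrable setT (EFin \o p).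
  apply/integrableP; split; first exact/measurable_EFinP.
  under eq_integral do rewrite gee0_abs ?lee_fin//.
  by rewrite p1 ltry.
have nu0 : nu set0 = 0 by rewrite /nu integral_set0.
have nu_ge0 A : 0 <= nu A by apply: integral_ge0 => x _; rewrite lee_fin.
have nu_sigma : semi_sigma_additive nu.
  move=> A mA tA mUA; rewrite /nu integral_bigcup//=; last first.
    exact: integrableS intp.
  by apply: is_cvg_ereal_nneg_natsum_cond => n _ _; exact: nu_ge0.
pose m1 := isMeasure.Build d T R nu nu0 nu_ge0 nu_sigma.
pose nuM : {measure set T -> \bar R} := HB.pack nu m1.
pose m2 := Measure_isProbability.Build d T R nuM p1.
pose q : probability T R := HB.pack nu m1 m2.
by exists q.
Qed.

End density.

(** * Gibbs' inequality and its equality case *)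

Lemma lnB_ge (R : realType) (a b : R) : 0 < a -> 0 < b ->
  1 - b * expR (- ln a) <= ln a - ln b ?= iff (a == b).
Proof.
move=> a0 b0.
(* With [x = ln b - ln a] the claim becomes [1 + x <= expR x], which is strict unless [x = 0]. *)
have -> : b * expR (- ln a) = expR (ln b - ln a) by rewrite expRD lnK// posrE.
split; first by have := expR_ge1Dx (ln b - ln a); lra.
have [->|ab] := eqVneq a b; first by apply/eqP; rewrite !subrr expR0 subrr.
apply/negbTE; rewrite lt_eqF//.
have /expR_gt1Dx : ln b - ln a != 0.
  by apply: contra_neq ab => /subr0_eq/esym/ln_inj ->; rewrite // posrE.
lra.
Qed.

Section gibbs.
Context d (T : measurableType d) (R : realType).
Local Open Scope classical_set_scope.
Local Open Scope ereal_scope.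
Implicit Types (g q : probability T R) (F p : T -> R).

(* [p * expR (- ln F)] is p / F where F > 0, and p where F = 0 since [ln 0 = 0];
   unlike p / F it is plainly measurable. *)
Lemma integral_likelihood_ratio g q F p : has_density g q F ->
  measurable_fun setT p -> (forall x, (0 <= p x)%R) ->
  \int[q]_x (p x * expR (- ln (F x)))%:E <= \int[g]_x (p x)%:E.
Proof.
move=> dF mp p0; have [mF F0 _] := dF.
have mV : measurable_fun setT (fun x => (p x * expR (- ln (F x)))%R).
  apply: measurable_funM => //; apply: measurableT_comp => //.
  by apply: measurable_funN; exact: measurableT_comp.
have r0 x : (0 <= p x * expR (- ln (F x)))%R by rewrite mulr_ge0 ?expR_ge0.
rewrite (ge0_integral_density dF)//; last exact/measurable_EFinP.
apply: ge0_le_integral => //.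
- by move=> x _; rewrite -EFinM lee_fin mulr_ge0.
- by apply/measurable_EFinP/measurable_funM.
- exact/measurable_EFinP.
- move=> x _; rewrite -EFinM lee_fin.
  (* The inequality can be strict only here: whatever [p] contributes on the set where [F] vanishes
     is lost. *)
  have [->|Fx] := eqVneq (F x) 0%R; first by rewrite mulr0.
  have Fpos : (0 < F x)%R by rewrite lt0r Fx F0.
  by rewrite expRN lnK ?posrE// divfK.
Qed.

(** Integrate [lnB_ge] with [a = F x] and [b = p x]: the lower bound [1 - p / F] has nonnegative
    [q]-integral because that of [p / F] is at most 1. If the integrals of the logarithms agree, the
    nonnegative excess integrates to 0, which puts [q]-almost every [x] in the equality case of
    [lnB_ge]. Since [ln F] may have infinite integral, finiteness is used only for [ln p]. *)
Lemma gibbs g q F p : has_density g q F ->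
  measurable_fun setT p -> (forall x, (0 < p x)%R) ->
  \int[g]_x (p x)%:E <= 1 -> q.-integrable setT (fun x => (ln (p x))%:E) ->
  \int[q]_x (ln (p x))%:E <= \int[q]_x (ln (F x))%:E /\
  (\int[q]_x (ln (F x))%:E <= \int[q]_x (ln (p x))%:E ->
   {ae q, forall x, F x = p x}).
Proof.
move=> dF mp p0 p1 intlnp; have [mF F0 _] := dF.
have mlnp : measurable_fun setT (fun x => ln (p x)) by exact: measurableT_comp.
have mlnF : measurable_fun setT (fun x => ln (F x)) by exact: measurableT_comp.
have mV : measurable_fun setT (fun x => (p x * expR (- ln (F x)))%R).
  apply: measurable_funM => //; apply: measurableT_comp => //.
  exact: measurable_funN.
have rle := le_trans (integral_likelihood_ratio dF mp (fun x => ltW (p0 x))) p1.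
have r0 x : (0 <= p x * expR (- ln (F x)))%R by rewrite mulr_ge0 ?expR_ge0// ltW.
have intr : q.-integrable setT (EFin \o (fun x => p x * expR (- ln (F x)))%R).
  apply/integrableP; split; first exact/measurable_EFinP.
  under eq_integral do rewrite gee0_abs ?lee_fin//.
  by apply: le_lt_trans rle _; rewrite ltry.
have int1 : q.-integrable setT (EFin \o cst (1%R : R)).
  exact: finite_measure_integrable_cst.
pose h x := (1 - p x * expR (- ln (F x)))%R.
have inth : q.-integrable setT (EFin \o h).
  by have := integrableB measurableT int1 intr; apply: eq_integrable.
have h_ge0 : 0 <= \int[q]_x (h x)%:E.
  rewrite /h integralB_EFin// integral_cst//.
  rewrite [X in 1 * X - _](_ : _ = 1); last exact: probability_setT.
  by rewrite mule1 sube_ge0 /= ?orbT.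
(* Where F > 0, i.e. q-a.e., the absolute value can be dropped by [lnB_ge]. *)
pose u x := `|ln (F x) - (ln (p x) + h x)|%R.
have mh : measurable_fun setT h by apply/measurable_EFinP; exact: measurable_int inth.
have meas_u : measurable_fun setT u.
  apply: measurableT_comp => //; apply: measurable_funB => //.
  exact: measurable_funD.
have u0 x : (0 <= u x)%R by exact: normr_ge0.
have Fpos := has_density_gt0 dF.
(* Almost everywhere [ln F = ln p + h + u], with [ln p] and [h] integrable and [u] merely
   nonnegative; hence [integralD_ge0] for the last sum. *)
have lnFE : \int[q]_x (ln (F x))%:E =
    \int[q]_x (ln (p x))%:E + \int[q]_x (h x)%:E + \int[q]_x (u x)%:E.
  rewrite -integralD_EFin// -integralD_ge0//; last first.
    have := integrableD measurableT intlnp inth; exact: eq_integrable.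
  apply: ae_eq_integral => //.
  - exact/measurable_EFinP.
  - by apply/measurable_EFinP; do 2 apply: measurable_funD => //.
  - apply: filterS Fpos => x Fx _; congr EFin.
    rewrite /u ger0_norm; first by rewrite [RHS]addrC subrK.
    have [le _] := lnB_ge Fx (p0 x).
    by rewrite subr_ge0 -lerBrDl.
have fin_h := integrable_fin_num measurableT inth.
have fin_p := integrable_fin_num measurableT intlnp.
have u_ge0 : 0 <= \int[q]_x (u x)%:E by apply: integral_ge0 => x _; rewrite lee_fin.
split.
  by rewrite lnFE -addeA leeDl// adde_ge0.
(* Cancelling the finite integral of [ln p] leaves a sum of two nonnegative integrals that is at
   most 0. *)
rewrite lnFE -addeA -[leRHS]adde0 leeD2lE// => hu.
have u_eq0 : \int[q]_x (u x)%:E = 0.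
  apply/eqP; rewrite eq_le u_ge0 andbT (le_trans _ hu)// leeDr//.
have : \int[q]_x `|(u x)%:E| = 0.
  by rewrite -[RHS]u_eq0; apply: eq_integral => x _; rewrite gee0_abs// lee_fin.
move/ae_eq_integral_abs => /(_ measurableT).
have meu : measurable_fun [set: T] (fun x => (u x)%:E) by exact/measurable_EFinP.
move=> /(_ meu); apply: filterS2 Fpos => x Fx /(_ I) [] ux.
have [_ eq] := lnB_ge Fx (p0 x).
move/eqP: ux; rewrite normr_eq0 subr_eq0 => /eqP e.
have lnB : (ln (F x) - ln (p x))%R = h x by rewrite e addrAC subrr add0r.
by apply/eqP; rewrite -eq lnB.
Qed.

(** Agreement [q]-a.e. says nothing on a [q]-null set that [g] may charge. Let [q'] have density
    [p]: off the exceptional set [M] the two measures coincide, so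
    [q A = q (A \ M) = q' (A \ M) <= q' A], and equal total masses turn this into equality. *)
Lemma has_density_ae g q F p : has_density g q F ->
  measurable_fun setT p -> (forall x, (0 <= p x)%R) ->
  \int[g]_x (p x)%:E = 1 -> {ae q, forall x, F x = p x} -> has_density g q p.
Proof.
move=> dF mp p0 p1 [M [mM M0 subM]]; have [mF F0 qE] := dF.
have [q' dq'] := probability_of_density mp p0 p1.
have [_ _ q'E] := dq'; split => // A mA; rewrite -q'E//.
apply: probability_le_eq mA => {}A mA.
have mAM : measurable (A `\` M) by exact: measurableD.
have -> : q A = q (A `\` M).
  rewrite (measureDI q mA mM) [X in _ + X](_ : _ = 0) ?adde0//.
  by apply: subset_measure0 M0 => //; exact: measurableI.
apply: (@le_trans _ _ (q' (A `\` M))); last first.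
  by apply: le_measure; rewrite ?inE//; exact: subDsetl.
rewrite qE// q'E// (eq_integral (fun x => (p x)%:E))//.
move=> x; rewrite inE => -[_ Mx]; congr EFin; apply: contrapT => Fp.
by apply: Mx; apply: subM.
Qed.

End gibbs.

(** * Kullback-Leibler divergence through a density *)

Section KL.
Context (R : realType).
Local Open Scope ereal_scope.
Implicit Types (g q : probability R R) (F : R -> R).

Lemma measurable_lne_EFin d (T : measurableType d) (f : T -> R) :
  measurable_fun setT f -> measurable_fun setT (fun x => lne (f x)%:E).
Proof.
move=> mf; apply: measurable_fun_ifT => //.
- exact: measurable_fun_ler.
- by apply/measurable_EFinP; exact: measurableT_comp.
Qed.

(** The [g]-a.e. equality of densities passes to [q] by absolute continuity. The extended [lne] and
    the real [ln] agree where [F] is positive, hence [q]-a.e. *)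
Lemma KL_density g q F : has_density g q F ->
  KL q g = \int[q]_x (ln (F x))%:E.
Proof.
move=> dF; have qg := has_density_dominates dF; have [mF _ _] := dF.
rewrite /KL asboolT//.
set f := Radon_Nikodym _ _.
have mf : measurable_fun setT f.
  exact: measurable_int (Radon_Nikodym_integrable _).
have fE x : f x = (fine (f x))%:E by rewrite fineK// Radon_Nikodym_fin_num.
apply: ae_eq_integral => //.
- rewrite (_ : (fun _ => _) = fun x => lne (fine (f x))%:E); last first.
    by apply/funext => x; rewrite -fE.
  apply: measurable_lne_EFin; apply/measurable_EFinP.
  by rewrite (_ : _ \o _ = f)//; apply/funext => x; rewrite /= -fE.
- by apply/measurable_EFinP; exact: measurableT_comp.
- have := null_dominates_ae_eq measurableT qg (has_density_Radon_Nikodym dF).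
  apply: filterS2 (has_density_gt0 dF) => x Fx /(_ I) fx _.
  have -> : f x = (F x)%:E := fx; exact: lne_EFin.
Qed.

End KL.

(** * Normal density: bounds and derivative in the mean *)

Lemma ler_norm_sqr (R : realType) (x : R) : `|x| <= 1 + x ^+ 2.
Proof.
rewrite -real_normK ?num_real//; have := sqr_ge0 (`|x| - 1).
by have := normr_ge0 x; nra.
Qed.

Section normal.
Context (R : realType) (s2 : R) (s2_gt0 : 0 < s2).
Local Open Scope classical_set_scope.
Implicit Types (b mu z : R) (g : probability R R).

Let k := normal_peak (Num.sqrt s2).

Let sqrt_neq0 : Num.sqrt s2 != 0.
Proof. by rewrite gt_eqF// sqrtr_gt0. Qed.

Lemma normal_peak_sqrt_gt0 : 0 < k.
Proof. exact: normal_peak_gt0. Qed.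

Lemma N_expR b mu : N b mu s2 = k * expR (- (b - mu) ^+ 2 / (2 * s2)).
Proof.
by rewrite /N normal_pdfE// /normal_fun sqr_sqrtr ?(ltW s2_gt0)// [2 * _]mulr_natl.
Qed.

Lemma NC b mu : N b mu s2 = N mu b s2.
Proof. by rewrite !N_expR -(sqrrN (b - mu)) opprB. Qed.

Lemma N_gt0 b mu : 0 < N b mu s2.
Proof. by rewrite N_expR mulr_gt0 ?expR_gt0 ?normal_peak_sqrt_gt0. Qed.

Lemma N_le_peak b mu : N b mu s2 <= k.
Proof. exact: normal_pdf_ub. Qed.

Lemma ln_N b mu : ln (N b mu s2) = ln k - (b - mu) ^+ 2 / (2 * s2).
Proof.
by rewrite N_expR lnM ?posrE ?expR_gt0 ?normal_peak_sqrt_gt0// expRK mulNr.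
Qed.

Lemma measurable_N mu : measurable_fun setT (fun b => N b mu s2).
Proof. exact: measurable_normal_pdf. Qed.

(** This is [t * expR (- t) <= 1] at [t = (b - mu)^2 / (2 s2)]. Such uniform bounds make the later
    integrands bounded, hence integrable against any [g], whatever its moments or atoms. *)
Lemma sqr_N_le b mu : (b - mu) ^+ 2 * N b mu s2 <= 2 * s2 * k.
Proof.
set t := (b - mu) ^+ 2 / (2 * s2).
have tE : (b - mu) ^+ 2 = 2 * s2 * t by rewrite /t; field; rewrite gt_eqF.
have te : t * expR (- t) <= 1.
  rewrite expRN ler_pdivrMr ?expR_gt0// mul1r.
  by apply: le_trans (expR_ge1Dx t); rewrite lerDr.
rewrite N_expR mulNr -/t tE.
rewrite (_ : _ * _ = 2 * s2 * k * (t * expR (- t))); last by ring.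
by rewrite ler_piMr// !mulr_ge0// ltW// normal_peak_sqrt_gt0.
Qed.

Lemma norm_N_le b mu : `|b - mu| * N b mu s2 <= k * (1 + 2 * s2).
Proof.
have /(ler_wpM2r (ltW (N_gt0 b mu)))/le_trans := ler_norm_sqr (b - mu); apply.
rewrite mulrDl mul1r mulrDr mulr1 lerD ?N_le_peak//.
by rewrite (mulrC k); exact: sqr_N_le.
Qed.

Lemma is_derive_N b mu :
  is_derive mu 1 (fun t => N b t s2) ((b - mu) / s2 * N b mu s2).
Proof.
(* The exponent is built from operations on functions so that the [is_derive] instances can compute
   its derivative. *)
pose h : R -> R := (- (2 * s2)^-1) *: ((cst b - id) ^+ 2).
have hE t : h t = - (b - t) ^+ 2 / (2 * s2).
  by rewrite /h /= [LHS]mulrC mulrN mulNr.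
have dh : is_derive mu 1 h ((b - mu) / s2).
  apply: is_derive_eq; rewrite /= sub0r expr1 /GRing.scale /=.
  rewrite (_ : (cst b - id) mu = b - mu)//.
  by field; rewrite gt_eqF.
rewrite (_ : (fun t => _) = k *: (expR \o h)); last first.
  by apply/funext => t; rewrite [LHS]N_expR -hE.
apply: is_derive_eq; rewrite N_expR -hE /GRing.scale /=; ring.
Qed.

(** * Marginal likelihood and its derivative *)

Lemma bounded_integrable g (f : R -> R) M : measurable_fun setT f ->
  (forall x, `|f x| <= M) -> g.-integrable setT (EFin \o f).
Proof.
move=> mf fM; apply: (@le_integrable _ _ _ _ _ _ (EFin \o f) (EFin \o cst M)) => //.
- exact/measurable_EFinP.
- by move=> x _; rewrite /= lee_fin (le_trans (fM x))// ler_norm.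
- exact: finite_measure_integrable_cst.
Qed.

Lemma integrable_N g mu : g.-integrable setT (EFin \o (fun b => N b mu s2)).
Proof.
apply: (@bounded_integrable _ _ k); first exact: measurable_N.
by move=> b; rewrite gtr0_norm ?N_gt0// N_le_peak.
Qed.

(** Symmetry of the kernel moves [z] to the mean argument, the one in which [is_derive_N]
    differentiates. *)
Lemma marginal_NME g z : marginal_NM z g s2 = (\int[g]_b N b z s2)%R.
Proof. by apply: eq_Rintegral => b _; exact: NC. Qed.

Lemma EFin_marginal_NM g z :
  (marginal_NM z g s2)%:E = (\int[g]_b (N b z s2)%:E)%E.
Proof.
rewrite marginal_NME /Rintegral fineK//.
exact: (integrable_fin_num measurableT (integrable_N g z)).
Qed.

(** If the integral of this positive function were 0, the whole line would be [g]-null, against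
    total mass 1. *)
Lemma marginal_NM_gt0 g z : 0 < marginal_NM z g s2.
Proof.
rewrite lt0r; apply/andP; split; last first.
  by rewrite -lee_fin EFin_marginal_NM integral_ge0// => b _; rewrite lee_fin ltW ?N_gt0.
apply/eqP => c0.
have : (\int[g]_b `|(N b z s2)%:E| = 0)%E.
  under eq_integral do rewrite gee0_abs ?lee_fin ?(ltW (N_gt0 _ _))//.
  by rewrite -EFin_marginal_NM c0.
move/ae_eq_integral_abs => /(_ measurableT).
have mN : measurable_fun [set: R] (fun b => (N b z s2)%:E).
  by apply/measurable_EFinP; exact: measurable_N.
move=> /(_ mN)[A [mA A0 subA]].
have AT : A = setT.
  rewrite -subTset => b _; apply: subA => /= /(_ I) [].
  by apply/eqP; rewrite gt_eqF ?N_gt0.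
have /eqP : (1 = 0 :> \bar R)%E.
  by rewrite -A0 AT; exact/esym/probability_setT.
by rewrite onee_eq0.
Qed.

Lemma is_derive_marginal_NM g z :
  is_derive z 1 (fun t => marginal_NM t g s2)
    (\int[g]_b ((b - z) / s2 * N b z s2))%R.
Proof.
rewrite (funext (marginal_NME g)).
pose f t b := N b t s2.
have d1f t b : partial1of2 f t b = (b - t) / s2 * N b t s2.
  by rewrite partial1of2E; have [_ <-] := is_derive_N b t.
(* The bound of [norm_N_le] divided by [s2]. It dominates the partial derivative uniformly in both
   variables, so the radius 1 of the interval around [z] is arbitrary. *)
pose M := k * (1 + 2 * s2) / s2.
have zI : `]z - 1, z + 1[ z by rewrite /= in_itv /= ltrBlDr !ltrDl ltr01.
have intf t : `]z - 1, z + 1[ t -> g.-integrable setT (EFin \o f t).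
  by move=> _; exact: integrable_N.
have df t b : `]z - 1, z + 1[ t -> setT b -> derivable (f ^~ b) t 1.
  by move=> _ _; have [] := is_derive_N b t.
have M0 (b : R) : 0 <= M.
  by rewrite divr_ge0 ?(ltW s2_gt0)// mulr_ge0 ?(ltW normal_peak_sqrt_gt0)//
     addr_ge0// mulr_ge0// ltW.
have intM : g.-integrable setT (EFin \o cst M) by exact: finite_measure_integrable_cst.
have ub t b : `]z - 1, z + 1[ t -> setT b -> `|partial1of2 f t b| <= cst M b.
  move=> _ _; rewrite d1f !normrM normfV [`|s2|]gtr0_norm// [`|N _ _ _|]gtr0_norm ?N_gt0//.
  by rewrite mulrAC /M ler_pM2r ?invr_gt0// norm_N_le.
apply: DeriveDef.
  exact: (derivable_under_integral measurableT zI intf df M0 intM ub).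
rewrite -derive1E.
rewrite (differentiation_under_integral measurableT zI intf df M0 intM ub).
by apply: eq_Rintegral => b _; exact: d1f.
Qed.

(** Tweedie's formula: the quotient is the posterior mean of [(b - z) / s2]. *)
Lemma l_NM'E g z :
  l_NM' z g s2 = (\int[g]_b ((b - z) / s2 * N b z s2))%R / marginal_NM z g s2.
Proof.
rewrite /l_NM' derive1E.
have dm := is_derive_marginal_NM g z.
have dln := is_derive1_ln (marginal_NM_gt0 g z).
by have [_ ->] := @is_derive1_comp _ (@ln R) (fun t => marginal_NM t g s2) _ _ _ dln dm;
  rewrite mulrC.
Qed.

(** * The posterior: existence, second moment and mean *)

Lemma posteriorP z g q :
  is_posterior_NM z s2 g q <->
  has_density g q (fun b => N b z s2 / marginal_NM z g s2).
Proof.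
split=> [qE|[] //]; split => //.
- by apply: measurable_funM => //; exact: measurable_N.
- by move=> b; rewrite divr_ge0 ?ltW ?N_gt0 ?marginal_NM_gt0.
Qed.

Lemma integral_posterior_density z g :
  (\int[g]_b (N b z s2 / marginal_NM z g s2)%:E)%E = 1%E.
Proof.
under eq_integral do rewrite EFinM.
rewrite integralZr//; last exact: integrable_N.
by rewrite -EFin_marginal_NM -EFinM divff// gt_eqF// marginal_NM_gt0.
Qed.

Lemma posterior_exists z g : exists q : probability R R, is_posterior_NM z s2 g q.
Proof.
have [||q dq] := probability_of_density _ _ (integral_posterior_density z g).
- by apply: measurable_funM => //; exact: measurable_N.
- by move=> b; rewrite divr_ge0 ?ltW ?N_gt0 ?marginal_NM_gt0.
- by exists q; apply/posteriorP.
Qed.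

Lemma integrable_sqr_id (q : probability R R) :
  ('E_q[fun b : R => (b ^+ 2)%R] < +oo)%E ->
  q.-integrable setT (fun b => (b ^+ 2)%:E) /\ q.-integrable setT (fun b => b%:E).
Proof.
rewrite unlock => Eoo.
have int2 : q.-integrable setT (fun b => (b ^+ 2)%:E).
  apply/integrableP; split.
    by apply/measurable_EFinP; exact: measurable_funX.
  by under eq_integral do rewrite gee0_abs ?lee_fin ?sqr_ge0//.
split => //.
have int1 : q.-integrable setT (EFin \o cst (1 : R)).
  exact: finite_measure_integrable_cst.
apply: le_integrable (integrableD measurableT int1 int2) => //.
  exact/measurable_EFinP.
move=> b _; rewrite /= lee_fin [leRHS]ger0_norm ?addr_ge0 ?sqr_ge0//.
exact: ler_norm_sqr.
Qed.

Lemma posterior_mean_constrained z g q theta :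
  theta = z + s2 * l_NM' z g s2 -> is_posterior_NM z s2 g q ->
  mean_constrained theta q.
Proof.
move=> thetaE /posteriorP dq; set c := marginal_NM z g s2 in dq.
have c0 : 0 < c := marginal_NM_gt0 g z.
have mN := measurable_N z.
have Eoo : ('E_q[fun b : R => (b ^+ 2)%R] < +oo)%E.
  rewrite unlock (ge0_integral_density dq).
  - apply: integrable_lty => //.
    apply: (@bounded_integrable _ (fun b => b ^+ 2 * (N b z s2 / c))
      (* From [b^2 <= 2 (b - z)^2 + 2 z^2], with [sqr_N_le] for the first term and [N_le_peak] for
         the second. *)
      ((2 * (2 * s2 * k) + 2 * z ^+ 2 * k) / c)).
      by apply: measurable_funM; [exact: measurable_funX|exact: measurable_funM].
    move=> b; rewrite ger0_norm; last first.
      by rewrite mulr_ge0 ?sqr_ge0// divr_ge0 ?ltW ?N_gt0.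
    rewrite mulrA ler_pM2r ?invr_gt0//.
    have := sqr_N_le b z; have := N_le_peak b z; have := N_gt0 b z.
    set n := N b z s2 => n0 nk bn.
    have : b ^+ 2 <= 2 * (b - z) ^+ 2 + 2 * z ^+ 2.
      by have := sqr_ge0 (b - 2 * z); nra.
    move=> /(ler_wpM2r (ltW n0))/le_trans; apply.
    rewrite mulrDl -[2 * _ * n]mulrA; apply: lerD; first by rewrite ler_pM2l.
    by apply: ler_wpM2l => //; rewrite mulr_ge0 ?sqr_ge0.
  - by move=> b; rewrite lee_fin sqr_ge0.
  - by apply/measurable_EFinP; exact: measurable_funX.
split => //.
have [_ int1] := integrable_sqr_id Eoo.
rewrite unlock (integral_density dq int1).
have intg1 : g.-integrable setT (EFin \o (fun b => (b - z) / s2 * N b z s2)).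
  apply: (@bounded_integrable _ _ (k * (1 + 2 * s2) / s2)).
    by apply: measurable_funM => //; apply: measurable_funM => //; exact: measurable_funB.
  move=> b; rewrite !normrM normfV [`|s2|]gtr0_norm// [`|N _ _ _|]gtr0_norm ?N_gt0//.
  by rewrite mulrAC ler_pM2r ?invr_gt0// norm_N_le.
have intN := integrable_N g z.
have ints := integrableZl measurableT (s2 / c) intg1.
have intz := integrableZl measurableT (z / c) intN.
(* Writing [b] as [s2 * ((b - z) / s2) + z] brings out the integral in [l_NM'E] and the marginal. *)
rewrite (_ : (fun b => _) = fun b =>
  ((s2 / c)%:E * ((b - z) / s2 * N b z s2)%:E + (z / c)%:E * (N b z s2)%:E)%E); last first.
  apply/funext => b; rewrite -!EFinM -EFinD; congr EFin.
  by field; rewrite !gt_eqF.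
rewrite (integralD measurableT ints intz).
rewrite (integralZl measurableT intg1) (integralZl measurableT intN).
rewrite -EFin_marginal_NM -/c.
rewrite -[X in (_ * X + _)%E]fineK; last exact: (integrable_fin_num measurableT intg1).
rewrite -!EFinM -EFinD; congr EFin.
rewrite thetaE l_NM'E /Rintegral -/c.
by field; rewrite gt_eqF.
Qed.

(** * The penalty under the mean constraint *)

Lemma integral_quadratic (q : probability R R) theta (al be ga : R) :
  mean_constrained theta q ->
  q.-integrable setT (fun b => (al * b ^+ 2 + be * b + ga)%:E) /\
  (\int[q]_b (al * b ^+ 2 + be * b + ga)%:E =
   (al * fine 'E_q[fun b : R => (b ^+ 2)%R] + be * theta + ga)%:E)%E.
Proof.
move=> [Eoo Eth]; have [int2 int1] := integrable_sqr_id Eoo.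
have i2 := integrableZl measurableT al int2.
have i1 := integrableZl measurableT be int1.
have i0 : q.-integrable setT (EFin \o cst ga).
  exact: finite_measure_integrable_cst.
have i21 := integrableD measurableT i2 i1.
split; first by have := integrableD measurableT i21 i0; apply: eq_integrable.
rewrite (integralD measurableT i21 i0) (integralD measurableT i2 i1).
rewrite (integralZl measurableT int2) (integralZl measurableT int1).
have -> : (\int[q]_b (EFin \o cst ga) b = ga%:E)%E.
  rewrite -[RHS]mule1 -(probability_setT q).
  exact: (@integral_cst _ _ _ q setT measurableT ga%:E).
rewrite -[X in (_ * X + _ + _)%E]fineK; last exact: (integrable_fin_num measurableT int2).
by move: Eth; rewrite unlock => ->; rewrite -!EFinM -!EFinD.
Qed.

Lemma variance_mean_constrained (q : probability R R) theta :
  mean_constrained theta q ->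
  'V_q[fun b : R => b]%E = (fine 'E_q[fun b : R => (b ^+ 2)%R]%E - theta ^+ 2)%:E.
Proof.
move=> mq; have [_ Eth] := mq.
have [_ int_quad] := integral_quadratic 1 (- (2 * theta)) (theta ^+ 2) mq.
rewrite /variance unlock Eth /=.
transitivity (\int[q]_b (1 * b ^+ 2 - 2 * theta * b + theta ^+ 2)%:E)%E.
  rewrite unlock; apply: eq_integral => b _; congr EFin.
  rewrite (_ : (_ * _) b = (b - theta) * (b - theta))//; ring.
transitivity (1 * fine 'E_q[fun b : R => (b ^+ 2)%R]%E
              + - (2 * theta) * theta + theta ^+ 2)%:E.
  by rewrite -int_quad; apply: eq_integral => b _; congr EFin; ring.
by congr EFin; ring.
Qed.

Lemma penalty_decomposition g q z theta :
  mean_constrained theta q ->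
  q.-integrable setT (fun b => (ln (N b z s2 / marginal_NM z g s2))%:E) /\
  penalty s2 g q =
  ((- l_NM z g s2 + ln (N z theta s2))%:E
   - \int[q]_b (ln (N b z s2 / marginal_NM z g s2))%:E + KL q g)%E.
Proof.
move=> mq; set c := marginal_NM z g s2.
have c0 : 0 < c := marginal_NM_gt0 g z.
pose al := - (2 * s2)^-1.
have lnpE b : ln (N b z s2 / c) =
    al * b ^+ 2 + z / s2 * b + (ln k - z ^+ 2 / (2 * s2) - ln c).
  rewrite ln_div ?posrE ?N_gt0// ln_N /al.
  by field; rewrite gt_eqF.
have [intq int_quad] := integral_quadratic al (z / s2) (ln k - z ^+ 2 / (2 * s2) - ln c) mq.
split.
  by apply: eq_integrable intq => // b _; rewrite lnpE.
rewrite /penalty (variance_mean_constrained mq).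
under eq_integral do rewrite lnpE.
rewrite int_quad -EFinM -EFinB; congr (_%:E + _)%E.
rewrite ln_N /l_NM -/c /al.
by field; rewrite gt_eqF.
Qed.

End normal.

(** * Lower bound, attainment and uniqueness *)

Section optimality.
Context (R : realType) (s2 z theta : R) (g : probability R R)
  (s2_gt0 : 0 < s2).
Local Open Scope ereal_scope.
Implicit Types q : probability R R.

Let C := (- l_NM z g s2 + ln (N z theta s2))%R.

Lemma penalty_ge q : mean_constrained theta q ->
  C%:E <= penalty s2 g q /\ (penalty s2 g q <= C%:E -> is_posterior_NM z s2 g q).
Proof.
move=> mq; have [intlnp ->] := penalty_decomposition s2_gt0 g z mq.
have finlnp := integrable_fin_num measurableT intlnp.
(* Without absolute continuity the penalty is [+oo]: the bound is trivial and the second claim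
   vacuous. *)
rewrite -/C; have [qg|nqg] := pselect (q `<< g); last first.
  rewrite /KL asboolF// addey; first by rewrite leey.
  by rewrite -(fineK finlnp).
have [F dF] := has_density_ex qg.
rewrite (KL_density dF).
have mN := measurable_N s2 z.
have pos b : (0 < N b z s2 / marginal_NM z g s2)%R.
  by rewrite divr_gt0 ?N_gt0 ?marginal_NM_gt0.
have mp : measurable_fun setT (fun b => N b z s2 / marginal_NM z g s2)%R.
  exact: measurable_funM.
have intp := integral_posterior_density s2_gt0 z g.
have [] := gibbs dF mp pos _ intlnp; first by rewrite intp.
move: finlnp; set L := integral q _ _ => finL Lle Lge.
(* Splitting [C] this way lets the finite [C - L] cancel, leaving exactly the two halves of
   [gibbs]. *)
have CE : C%:E = C%:E - L + L by rewrite subeK.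
have finCL : C%:E - L \is a fin_num by rewrite fin_numB finL.
split; first by rewrite [leLHS]CE leeD2lE.
rewrite [leRHS]CE leeD2lE// => /Lge Fp.
apply/(posteriorP s2_gt0)/(has_density_ae dF) => // b; exact: ltW.
Qed.

Lemma penalty_posterior q : mean_constrained theta q ->
  is_posterior_NM z s2 g q -> penalty s2 g q = C%:E.
Proof.
move=> mq pq; have [intlnp ->] := penalty_decomposition s2_gt0 g z mq.
have finlnp := integrable_fin_num measurableT intlnp.
by rewrite (KL_density ((posteriorP s2_gt0 z g q).1 pq)) subeK.
Qed.

Context (thetaE : theta = (z + s2 * l_NM' z g s2)%R).

(** The posterior is admissible by Tweedie's formula and attains [C]. An optimal [q] therefore has
    penalty at most [C], and the equality case in [penalty_ge] identifies it. *)
Lemma is_optimalP q :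
  is_optimal theta s2 g q <-> is_posterior_NM z s2 g q.
Proof.
split=> [[mq opt]|pq].
  have [q' pq'] := posterior_exists s2_gt0 z g.
  have mq' := posterior_mean_constrained s2_gt0 thetaE pq'.
  have [_] := penalty_ge mq; apply.
  by rewrite -(penalty_posterior mq' pq') opt.
have mq := posterior_mean_constrained s2_gt0 thetaE pq.
split=> // q' mq'; rewrite (penalty_posterior mq pq).
by have [] := penalty_ge mq'.
Qed.

Lemma ereal_inf_penalty :
  ereal_inf [set penalty s2 g q | q in mean_constrained theta]%classic = C%:E.
Proof.
have [q pq] := posterior_exists s2_gt0 z g.
have mq := posterior_mean_constrained s2_gt0 thetaE pq.
apply/eqP; rewrite eq_le; apply/andP; split.
  by apply: ereal_inf_lbound; exists q => //; exact: penalty_posterior.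
by apply: le_ereal_inf_tmp => _ [q' mq' <-]; have [] := penalty_ge mq'.
Qed.

End optimality.

(** * Application to the generalized linear model *)

Lemma glm_s2_gt0 (R : realType) (n p : nat) (m : canonical_glm R n p)
    (theta : 'cV[R]_p) (j : 'I_p) :
  0 < glm_information m theta j -> 0 < glm_s2 m theta j.
Proof. by move=> i0; rewrite divr_gt0// glm_a_gt0. Qed.

Theorem theorem2p2 (R : realType) (n p : nat) (m : canonical_glm R n p)
    (theta : 'cV[R]_p) (g : probability R R)
    (info_gt0 : forall j : 'I_p, 0 < glm_information m theta j)
    (z : 'I_p -> R)
    (z_sol : forall j : 'I_p,
       theta j 0 = z j + glm_s2 m theta j * l_NM' (z j) g (glm_s2 m theta j)) :
  forall j : 'I_p,
    glm_r m theta g j =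
      (- l_NM (z j) g (glm_s2 m theta j)
       + ln (N (z j) (theta j 0) (glm_s2 m theta j)))%:E
    /\ (exists q : probability R R,
          is_optimal (theta j 0) (glm_s2 m theta j) g q)
    /\ (forall q : probability R R,
          is_optimal (theta j 0) (glm_s2 m theta j) g q <->
          is_posterior_NM (z j) (glm_s2 m theta j) g q).
Proof.
move=> j; have s2_gt0 := glm_s2_gt0 (info_gt0 j).
split; first exact: ereal_inf_penalty.
split=> [|q]; last exact: is_optimalP.
have [q pq] := posterior_exists s2_gt0 (z j) g.
by exists q; apply/(is_optimalP s2_gt0 (z_sol j)).
Qed.
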